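(* There is an absolute constant $C>0$, not exceeding the positive root of the equation $\zeta^{3}-3\zeta-1=0$, such that the following holds. Let $(\mathcal{M},\mathfrak{g}=\langle\cdot,\cdot\rangle)$ be a smooth complete Riemannian manifold and let $x(\cdot):\mathbb{R}\to\mathcal{M}$ be a smooth mapping such that $\|\nabla_{\dot{x}}\dot{x}(\cdot)\|_{\infty}<\infty$. Suppose that there exists a smooth function $U(\cdot):\mathcal{M}\to\mathbb{R}$ satisfying $$\sup_{t\in\mathbb{R}}U(x(t))<\infty,\qquad 0<\|\nabla U\circ x(\cdot)\|_{\infty}<\infty,$$ $$\lambda:=\inf_{t\in\mathbb{R}}\min\left\{\langle\nabla_{\xi}\nabla U(x(t)),\xi\rangle:\ \xi\in T_{x(t)}\mathcal{M},\ \|\xi\|=1\right\}>0.$$ Then $$\|\dot{x}(\cdot)\|_{\infty}^{2}\le\frac{C^{2}}{\lambda}\,\|\nabla U\circ x(\cdot)\|_{\infty}\,\|\nabla_{\dot{x}}\dot{x}(\cdot)\|_{\infty}.$$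
   Context: $\nabla$ is the Levi-Civita connection of $(\mathcal{M},\mathfrak{g})$, and $\|\cdot\|$ is the norm on the tangent spaces $T_x\mathcal{M}$ associated with $\langle\cdot,\cdot\rangle$. $\dot{x}(t)\in T_{x(t)}\mathcal{M}$ is the tangent vector of the mapping $x(\cdot)$ at the point $x(t)$, and $\nabla_{\dot{x}}\dot{x}(t)$ is the covariant derivative of the vector field $\dot{x}(\cdot)$ along the mapping $x(\cdot)$. $\nabla U(x)\in T_x\mathcal{M}$ is the gradient of $U$ at $x\in\mathcal{M}$, and $\nabla U\circ x(t)=\nabla U(x(t))$. For a vector field $X$ on $\mathcal{M}$ and $\xi\in T_x\mathcal{M}$, $\nabla_{\xi}X(x)$ is the covariant derivative of $X$ at $x$ in the direction $\xi$; thus $\langle\nabla_\xi\nabla U(x),\xi\rangle$ is the Hessian quadratic form of $U$ at $x$. For a vector field $\xi(\cdot)$ along $x(\cdot)$, $\|\xi(\cdot)\|_{\infty}:=\sup_{t\in\mathbb{R}}\|\xi(t)\|$. *)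

(* Defs.v *)
From HB Require Import structures.
From mathcomp Require Import all_boot all_order all_algebra.
From mathcomp Require Import all_classical all_reals all_analysis.

Set Implicit Arguments.
Unset Strict Implicit.
Unset Printing Implicit Defensive.

Import Order.TTheory GRing.Theory Num.Theory.
Import numFieldNormedType.Exports.

Local Open Scope classical_set_scope.
Local Open Scope ring_scope.

(* Meaningful for open [A]. All iterated directional derivatives exist and are
   Frechet differentiable, hence continuous, on [A]; in finite dimension this
   is C^oo. *)
Definition smooth_on (R : realType) (V W : normedModType R)
    (A : set V) (f : V -> W) : Prop :=
  forall (vs : seq V) (x : V), A x ->
    differentiable (foldr (fun v h => 'D_v h) f vs) x.

(* [chart_map] and [chart_inv] are total functions; only their values on
   [chart_dom] and on its image matter. *)
Record chart (R : realType) (n : nat) (T : topologicalType) := Chart {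
  chart_dom : set T;
  chart_map : T -> 'rV[R]_n;
  chart_inv : 'rV[R]_n -> T;
  chart_dom_open : open chart_dom;
  chart_im_open : open (chart_map @` chart_dom);
  chart_mapK : forall p, chart_dom p -> chart_inv (chart_map p) = p;
  chart_map_continuous :
    forall p, chart_dom p -> {for p, continuous chart_map};
  chart_inv_continuous :
    forall y, (chart_map @` chart_dom) y -> {for y, continuous chart_inv}
}.

(* As in the bundled approach to tangent bundles, every point carries a
   preferred chart, which only serves to represent tangent vectors. *)
Record smoothManifold (R : realType) (n : nat) := SmoothManifold {
  carrier :> topologicalType;
  carrier_hausdorff : hausdorff_space carrier;
  carrier_second_countable : @second_countable carrier;
  atlas : set (chart R n carrier);
  transition_smooth : forall c c', atlas c -> atlas c' ->
    smooth_on (chart_map c @` (chart_dom c `&` chart_dom c'))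
              (chart_map c' \o chart_inv c);
  chart_at : carrier -> chart R n carrier;
  chart_at_atlas : forall p, atlas (chart_at p);
  chart_at_dom : forall p, chart_dom (chart_at p) p
}.

Section Manifold.
Variables (R : realType) (n : nat) (M : smoothManifold R n).

Definition chart_im (c : chart R n M) : set 'rV[R]_n :=
  chart_map c @` chart_dom c.

Definition smooth_function (f : M -> R) : Prop :=
  forall c, atlas c -> smooth_on (chart_im c) (f \o chart_inv c).

Definition smooth_curve (x : R -> M) : Prop :=
  continuous x /\
  forall c, atlas c -> smooth_on (x @^-1` chart_dom c) (chart_map c \o x).

(* T_p M: a tangent vector is given by its components in [chart_at M p]. *)
Definition tangent (p : M) : Type := 'rV[R]_n.

(* For [p] in the domain of [c], [components c] gives the components in the
   chart [c] of a tangent vector at [p], and [of_components c] is its inverse: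
   both are differentials of transition maps. *)
Definition components (c : chart R n M) (p : M) (v : tangent p) : 'rV[R]_n :=
  'D_v (chart_map c \o chart_inv (chart_at p)) (chart_map (chart_at p) p).

Definition of_components (c : chart R n M) (p : M) (u : 'rV[R]_n) : tangent p :=
  'D_u (chart_map (chart_at p) \o chart_inv c) (chart_map c p).

Definition velocity (x : R -> M) (t : R) : tangent (x t) :=
  derive1 (chart_map (chart_at (x t)) \o x) t.

(* [gram_of inn c y] is the matrix (g_ij) in the chart [c], at the point of
   coordinates [y]. *)
Definition gram_of (inn : forall p : M, tangent p -> tangent p -> R)
    (c : chart R n M) (y : 'rV[R]_n) : 'M[R]_n :=
  let p := chart_inv c y in
  \matrix_(i, j) inn p (of_components c p (delta_mx 0 i))
                       (of_components c p (delta_mx 0 j)).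

Record riemannianMetric := RiemannianMetric {
  inner : forall p : M, tangent p -> tangent p -> R;
  inner_linearl : forall (p : M) (a : R) (u v w : 'rV[R]_n),
    inner (p := p) (a *: u + v) w = a * inner (p := p) u w + inner (p := p) v w;
  inner_sym : forall (p : M) (u v : tangent p), inner u v = inner v u;
  inner_gt0 : forall (p : M) (u : 'rV[R]_n), u != 0 -> 0 < inner (p := p) u u;
  inner_smooth : forall c, atlas c -> forall i j : 'I_n,
    smooth_on (chart_im c) (fun y => gram_of inner c y i j)
}.

Variable g : riemannianMetric.

Definition gram (c : chart R n M) (y : 'rV[R]_n) : 'M[R]_n :=
  gram_of (inner g) c y.

Definition tangent_norm (p : M) (v : tangent p) : R := Num.sqrt (inner g v v).

Definition dgram (c : chart R n M) (y : 'rV[R]_n) (l i j : 'I_n) : R :=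
  'D_(delta_mx 0 l) (fun z => gram c z i j) y.

(* Gamma^k_ij of the Levi-Civita connection:
   1/2 g^kl (d_i g_jl + d_j g_il - d_l g_ij). *)
Definition christoffel (c : chart R n M) (y : 'rV[R]_n) (k i j : 'I_n) : R :=
  2^-1 * \sum_l invmx (gram c y) k l *
           (dgram c y i j l + dgram c y j i l - dgram c y l i j).

Definition christoffel_form (c : chart R n M) (y u v : 'rV[R]_n) : 'rV[R]_n :=
  \row_k \sum_i \sum_j christoffel c y k i j * u 0 i * v 0 j.

(* The covariant derivatives below are computed in the preferred chart of the
   base point, in which the components of a tangent vector at that point are
   the vector itself; the result does not depend on the chart. *)

(* nabla_xi X (p) *)
Definition cov_deriv (X : forall q : M, tangent q) (p : M) (xi : tangent p) :
    tangent p :=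
  let c := chart_at p in
  let y := chart_map c p in
  'D_xi (fun z => components c (X (chart_inv c z))) y
    + christoffel_form c y xi (X p).

(* Covariant derivative along [x] of the vector field [X] along [x]. *)
Definition cov_deriv_along (x : R -> M) (X : forall t, tangent (x t)) (t : R) :
    tangent (x t) :=
  let c := chart_at (x t) in
  derive1 (fun s => components c (X s)) t
    + christoffel_form c (chart_map c (x t)) (velocity x t) (X t).

Definition acceleration (x : R -> M) (t : R) : tangent (x t) :=
  cov_deriv_along (velocity x) t.

(* g^ij d_j U *)
Definition gradient (U : M -> R) (p : M) : tangent p :=
  let c := chart_at p in
  let y := chart_map c p in
  (\row_j 'D_(delta_mx 0 j) (U \o chart_inv c) y) *m invmx (gram c y).

Definition hessian_form (U : M -> R) (p : M) (xi : tangent p) : R :=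
  inner g (cov_deriv (gradient U) xi) xi.

(* The minimum of the Hessian form over the unit sphere of T_p M. It is a true
   minimum, the sphere being compact, unless [n = 0], when it is [+oo]. *)
Definition hessian_min (U : M -> R) (p : M) : \bar R :=
  ereal_inf [set (hessian_form U xi)%:E
            | xi in [set xi : tangent p | tangent_norm xi = 1]].

Definition sup_norm (x : R -> M) (X : forall t, tangent (x t)) : \bar R :=
  ereal_sup [set (tangent_norm (X t))%:E | t in [set: R]].

Definition geodesic (x : R -> M) : Prop :=
  smooth_curve x /\ forall t, acceleration x t = 0 :> 'rV[R]_n.

(* Geodesic completeness. *)
Definition complete_metric : Prop :=
  forall (p : M) (v : tangent p), exists x : R -> M,
    [/\ geodesic x, x 0 = p & velocity x 0 = v :> 'rV[R]_n].

End Manifold.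

(* Main.v *)
Require Import Defs.
From HB Require Import structures.
From mathcomp Require Import all_boot all_order all_algebra.
From mathcomp Require Import all_classical all_reals all_analysis.
From mathcomp Require Import ring lra.
Import Order.TTheory GRing.Theory Num.Theory.
Import numFieldNormedType.Exports.
Local Open Scope classical_set_scope.
Local Open Scope ring_scope.

(** Write [f t = U (x t)], let [v] be the speed of [x], [A] the supremum of the
    norm of the acceleration and [G] that of the gradient of [U] along [x].

    Geometry enters only through the compatibility of the connection with the
    metric ([is_derive_inner]), which gives [f' = <grad U, x'>] and
    [f'' = Hess U (x', x') + <grad U, x''>] ([is_derive_potential],
    [is_derive2_potential]) and [(v^2)' = 2 <x'', x'>] ([is_derive_speed2]).
    By Cauchy-Schwarz, [|f'| <= G v], [f'' >= lambda v^2 - G A], and [v] is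
    [A]-Lipschitz ([sqrt_lipschitz]).

    What remains concerns functions of one real variable.  Let [w] be the
    critical speed, [lambda w^2 = G A], at which the lower bound on [f'']
    vanishes, and [zeta] the positive root of [z^3 - 3 z - 1].  Suppose that
    [v t0 = v0 > zeta w]; reversing time, one may assume [f' t0 >= 0].  The speed decreases at rate at most [A],
    so it stays above [w] on an interval of length [(v0 - w) / A]; integrating
    the lower bound on [f''] there shows that [f'] reaches at least
    [lambda (v0^3 - w^3) / (3 A) - G (v0 - w)], which exceeds [G w] exactly when
    [(v0 / w)^3 - 3 (v0 / w) - 1 > 0].  This is where the cubic comes from.
    Once [f' > G w], the bound [|f'| <= G v] forces [v > w], hence [f'' > 0]:
    [f'] can never come back down ([barrier]), and [f] grows at least linearly,
    against its boundedness from above ([supercritical_speed_le], [speed_le]).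
    So [C = zeta] works.

    In coordinates, [is_derive_inner] is the product rule applied to
    [g_ij X^i W^j] in one fixed chart, combined with the identity
    [d_l g_ij = g_kj Gamma^k_li + g_ik Gamma^k_lj] ([christoffel_compat]).
    Tangent vectors at the various points of the curve are stored in different
    charts; the chain rule on transition maps ([derive_transition]) brings them
    to the fixed one. *)

Set Implicit Arguments.
Unset Strict Implicit.
Unset Printing Implicit Defensive.

(** * Functions of one real variable *)

Section RealLine.
Variable R : realType.
Implicit Types (f df g dg : R -> R) (a b c t : R).

Lemma is_derive_continuous f (l t : R) : is_derive t 1 f l -> {for t, continuous f}.
Proof.
by move=> [/derivable1_diffP /differentiable_continuous].
Qed.

Lemma increment_le f df g dg a b :
  (forall t, is_derive t 1 f (df t)) -> (forall t, is_derive t 1 g (dg t)) ->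
  a <= b -> (forall t, a < t < b -> df t <= dg t) ->
  f b - f a <= g b - g a.
Proof.
move=> fP gP ab dfg.
have hP t : is_derive t 1 (g - f) (dg t - df t) by exact: is_deriveB.
suff : (g - f) a <= (g - f) b by rewrite -![(g - f) _]/(_ - _); lra.
apply: (@ger0_derive1_ndecr R (g - f) a b) => //.
- by move=> t; rewrite in_itv derive1E (@derive_val _ _ _ _ _ _ _ (hP t)) subr_ge0; exact: dfg.
- by apply: continuous_subspaceT => t; exact: is_derive_continuous (hP t).
Qed.

(** A maximum point of [f] on [[a, b]] has value at least [c], so the derivative
    there is positive and the point can only be [b]. *)
Lemma barrier f df a c :
  (forall t, is_derive t 1 f (df t)) -> c <= f a ->
  (forall t, a <= t -> c <= f t -> 0 < df t) ->
  forall t, a <= t -> c <= f t.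
Proof.
move=> fP ca fgt0 b ab; rewrite leNgt; apply/negP => fbc.
have [|m] := @EVT_max R f a b ab.
  by apply: continuous_subspaceT => t; exact: is_derive_continuous (fP t).
rewrite in_itv /= => /andP[am mb] max_m.
have fm : c <= f m by apply: le_trans (max_m a _) => //; rewrite in_itv /= lexx.
have {}mb : m < b.
  by rewrite lt_neqAle mb andbT; apply/eqP => mbE; move: fbc; rewrite -mbE ltNge fm.
have dfm := fgt0 _ am fm.
have fl : h^-1 *: (f (h *: 1 + m) - f m) @[h --> 0^'] --> df m.
  by have [fm' <-] := fP m; exact: fm'.
have H : \forall h \near 0^', 0 < h^-1 *: (f (h *: 1 + m) - f m).
  exact: (cvgr_gt _ fl _ dfm).
have H1 : \forall h \near 0^'+, 0 < h^-1 *: (f (h *: 1 + m) - f m).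
  by move: H; rewrite !near_withinE; apply: filterS => h Hh h0; apply: Hh; rewrite gt_eqF.
have [h [h0 hb hd]] : exists h, [/\ 0 < h, h < b - m & 0 < h^-1 *: (f (h *: 1 + m) - f m)].
  near (0:R)^'+ => h; exists h; split => //; near: h => //.
  by apply: nbhs_right_lt; rewrite subr_gt0.
move: hd; rewrite /GRing.scale /= mulr1 pmulr_rgt0 ?invr_gt0 // subr_gt0 ltNge.
by rewrite max_m // in_itv /=; apply/andP; split; lra.
Unshelve. all: by end_near. Qed.

(** The cubic [v0^3 - 3 w^2 v0 - w^3] is, up to a positive factor, the excess of
    the lower bound on [df t1] over [G * w], where [t1] is the first time at
    which the speed can have dropped to the critical value [w].  If it were
    positive, [df] would remain at least [df t1 > G * w] from [t1] on, and [f]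
    would be unbounded. *)
Lemma supercritical_speed_le f df ddf (v : R -> R) (A G lam w B t0 : R) :
  0 < A -> 0 < G -> 0 < lam -> 0 < w -> lam * w ^+ 2 = G * A ->
  (forall t, is_derive t 1 f (df t)) -> (forall t, is_derive t 1 df (ddf t)) ->
  (forall s t, `|v t - v s| <= A * `|t - s|) ->
  (forall t, `|df t| <= G * v t) ->
  (forall t, lam * v t ^+ 2 - G * A <= ddf t) ->
  (forall t, f t <= B) ->
  0 <= df t0 -> w <= v t0 ->
  v t0 ^+ 3 - 3 * w ^+ 2 * v t0 - w ^+ 3 <= 0.
Proof.
move=> A0 G0 l0 w0 lwE fP dfP vlip dfle ddfge fB dft0 wv.
rewrite leNgt; apply/negP => v0gt.
set v0 := v t0 in wv v0gt.
pose t1 := t0 + (v0 - w) / A.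
have t01 : t0 <= t1 by rewrite lerDl divr_ge0 ?subr_ge0 // ltW.
(* a primitive of the lower bound on ddf that the Lipschitz bound gives *)
pose P t := - (lam / (3 * A)) * (v0 - A * (t - t0)) ^+ 3 - G * A * t.
pose dP t := lam * (v0 - A * (t - t0)) ^+ 2 - G * A.
have PP t : is_derive t 1 P (dP t).
  rewrite /P; apply: is_derive_eq.
  by rewrite /dP /GRing.scale /=; field; rewrite gt_eqF.
have dft1 : P t1 - P t0 <= df t1 - df t0.
  apply: (@increment_le P dP df ddf) => // t /andP[t0t tt1].
  apply: le_trans (ddfge t); rewrite lerD2r ler_pM2l //.
  have At : A * (t - t0) <= v0 - w.
    by rewrite mulrC -ler_pdivlMr // lerBlDl ltW.
  have := vlip t0 t; rewrite -/v0 (@gtr0_norm _ (t - t0)) ?subr_gt0 // ler_norml => /andP[? _].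
  by rewrite ler_sqr ?nnegrE; nra.
have Gw : G * w < df t1.
  have : G * w < P t1 - P t0.
    rewrite /P.
    have -> : v0 - A * (t1 - t0) = w by rewrite /t1; field; rewrite gt_eqF.
    have -> : t1 = t0 + (v0 - w) / A by [].
    have -> : v0 - A * (t0 - t0) = v0 by ring.
    have -> : - (lam / (3 * A)) * w ^+ 3 - G * A * (t0 + (v0 - w) / A) -
        (- (lam / (3 * A)) * v0 ^+ 3 - G * A * t0) =
        lam / (3 * A) * (v0 ^+ 3 - w ^+ 3) - G * (v0 - w).
      by field; rewrite gt_eqF.
    have -> : G = lam * w ^+ 2 / A by rewrite lwE mulfK // gt_eqF.
    have : 0 < lam / (3 * A) * (v0 ^+ 3 - 3 * w ^+ 2 * v0 - w ^+ 3).
      by rewrite mulr_gt0 // divr_gt0 // mulr_gt0.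
    suff -> : lam / (3 * A) * (v0 ^+ 3 - 3 * w ^+ 2 * v0 - w ^+ 3) =
        lam / (3 * A) * (v0 ^+ 3 - w ^+ 3) - lam * w ^+ 2 / A * (v0 - w) -
        lam * w ^+ 2 / A * w by rewrite subr_gt0.
    by field; rewrite gt_eqF.
  by lra.
have v1 t : df t1 <= df t -> w < v t.
  move=> dft; rewrite -(ltr_pM2l G0); apply: lt_le_trans (dfle t).
  by rewrite (lt_le_trans Gw) // (le_trans dft) // ler_norm.
have dfge : forall t, t1 <= t -> df t1 <= df t.
  apply: (barrier dfP (lexx _)) => t _ /v1 wvt; apply: lt_le_trans (ddfge t).
  by rewrite -lwE subr_gt0 ltr_pM2l // ltr_sqr ?nnegrE ?(ltW w0) // ltW // (lt_trans w0).
have dft1_gt0 : 0 < df t1 by rewrite (lt_trans _ Gw) // mulr_gt0.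
(* growing at rate df t1, f would exceed B by 1 at time t2 *)
pose t2 := t1 + (B - f t1 + 1) / df t1.
have t12 : t1 <= t2 by rewrite lerDl divr_ge0 ?(ltW dft1_gt0) //; have := fB t1; lra.
have lP t : is_derive t 1 (fun s => df t1 * s) (df t1).
  by apply: is_derive_eq; rewrite /GRing.scale /= mulr1.
have := increment_le lP fP t12 (fun t h => dfge t (ltW (proj1 (andP h)))).
have -> : df t1 * t2 - df t1 * t1 = B - f t1 + 1.
  by rewrite /t2; field; rewrite gt_eqF.
by have := fB t2; lra.
Qed.

(** A positive root has [z^2 > 3], since [z (z^2 - 3) = 1]; two distinct
    positive roots [c], [d] would satisfy [c^2 + c d + d^2 = 3]. *)
Lemma cubic_root_exists : exists z : R, unique (fun z : R => 0 < z /\ z ^+ 3 - 3 * z - 1 = 0) z.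
Proof.
have [||c] := @IVT R (fun z => z ^+ 3 - 3 * z - 1) 1 2 0 ltac:(lra).
- apply: continuous_subspaceT => z.
  apply: (@is_derive_continuous _ (3 * z ^+ 2 - 3)).
  by apply: is_derive_eq; rewrite /GRing.scale /=; ring.
- rewrite ge_min le_max; lra.
rewrite in_itv /= => /andP[c1 _] c0; exists c; split; first by split=> //; lra.
move=> d [d0 dE].
have c3 : 3 < c ^+ 2 by nra.
have d3 : 3 < d ^+ 2 by nra.
have : (c - d) * (c ^+ 2 + c * d + d ^+ 2 - 3) = 0 by lra.
move/eqP; rewrite mulf_eq0 subr_eq0 => /orP[/eqP //|/eqP E].
by nra.
Qed.

Lemma cubic_pos (z u : R) : 0 < z -> z ^+ 3 - 3 * z - 1 = 0 -> z < u ->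
  0 < u ^+ 3 - 3 * u - 1.
Proof.
move=> z0 zE zu.
have z3 : 3 < z ^+ 2 by nra.
have -> : u ^+ 3 - 3 * u - 1 = (u - z) * (u ^+ 2 + u * z + z ^+ 2 - 3).
  by transitivity (u ^+ 3 - 3 * u - 1 - (z ^+ 3 - 3 * z - 1)); [rewrite zE subr0|ring].
apply: mulr_gt0; first by rewrite subr_gt0.
by nra.
Qed.

(** The previous bound is applied for every [A' > A], and [A'] tends to [A]: this
    covers the case [A = 0], in which there is no positive critical speed.  For
    [df t0 < 0], it is applied to the functions of [- t]. *)
Lemma speed_le f df ddf (v : R -> R) (A G lam B zeta t0 : R) :
  0 < zeta -> zeta ^+ 3 - 3 * zeta - 1 = 0 ->
  0 <= A -> 0 < G -> 0 < lam ->
  (forall t, is_derive t 1 f (df t)) -> (forall t, is_derive t 1 df (ddf t)) ->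
  (forall s t, `|v t - v s| <= A * `|t - s|) ->
  (forall t, `|df t| <= G * v t) ->
  (forall t, lam * v t ^+ 2 - G * A <= ddf t) ->
  (forall t, f t <= B) ->
  v t0 ^+ 2 <= zeta ^+ 2 / lam * G * A.
Proof.
move=> z0 zE A0 G0 l0 fP dfP vlip dfle ddfge fB.
wlog df0 : f df ddf v t0 fP dfP vlip dfle ddfge fB / 0 <= df t0.
  move=> wl; case: (leP 0 (df t0)) => [|dft0]; first exact: wl.
  rewrite -[t0]opprK; apply: (wl (fun t => f (- t)) (fun t => - df (- t))
    (fun t => ddf (- t)) (fun t => v (- t))) => //.
  - move=> t; have := fP (- t) => H.
    by apply: is_derive_eq; rewrite /GRing.scale /= mulrN1.
  - move=> t; have := dfP (- t) => H.
    by apply: is_derive_eq; rewrite /GRing.scale /= mulrN1 opprK.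
  - by move=> s t; rewrite (le_trans (vlip _ _)) // -opprD normrN.
  - by move=> t; rewrite normrN.
  - by rewrite opprK oppr_ge0 ltW.
suff H A' : A < A' -> v t0 ^+ 2 <= zeta ^+ 2 / lam * G * A'.
  apply/ler_addgt0Pr => e e0.
  have k0 : 0 < zeta ^+ 2 / lam * G by rewrite !mulr_gt0 ?invr_gt0.
  apply: le_trans (H (A + e / (zeta ^+ 2 / lam * G)) _) _; first by rewrite ltrDl divr_gt0.
  by rewrite mulrDr mulrCA divff ?mulr1 // gt_eqF.
move=> AA'.
have A'0 : 0 < A' by exact: le_lt_trans AA'.
pose w := Num.sqrt (G * A' / lam).
have w0 : 0 < w by rewrite sqrtr_gt0 divr_gt0 // mulr_gt0.
have w2 : w ^+ 2 = G * A' / lam by rewrite sqr_sqrtr // ltW // divr_gt0 // mulr_gt0.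
have lwE : lam * w ^+ 2 = G * A' by rewrite w2 mulrC divfK // gt_eqF.
have -> : zeta ^+ 2 / lam * G * A' = (zeta * w) ^+ 2 by rewrite exprMn w2; ring.
have v0 t : 0 <= v t by rewrite -(pmulr_rge0 _ G0) (le_trans _ (dfle t)).
rewrite ler_sqr ?nnegrE ?mulr_ge0 ?(ltW z0) ?(ltW w0) // leNgt; apply/negP => zwv.
have z1 : 1 <= zeta by nra.
have wv : w <= v t0 by nra.
have := @supercritical_speed_le f df ddf v A' G lam w B t0 A'0 G0 l0 w0 lwE fP dfP.
suff : 0 < v t0 ^+ 3 - 3 * w ^+ 2 * v t0 - w ^+ 3.
  rewrite ltNge => /negP H K; apply: H; apply: K => //.
  - by move=> s t; rewrite (le_trans (vlip _ _)) // ler_wpM2r // ltW.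
  - by move=> t; rewrite (le_trans _ (ddfge t)) // lerD2l lerN2 ler_pM2l // ltW.
have -> : v t0 ^+ 3 - 3 * w ^+ 2 * v t0 - w ^+ 3 =
   w ^+ 3 * ((v t0 / w) ^+ 3 - 3 * (v t0 / w) - 1) by field; rewrite gt_eqF.
by rewrite mulr_gt0 ?exprn_gt0 // (@cubic_pos zeta) // ltr_pdivlMr.
Qed.

(** The square root is smooth only away from 0: the estimate is proved for
    [Num.sqrt (q + e)], [e > 0], whose derivative is bounded by [A], and [e] is
    sent to 0. *)
Lemma sqrt_lipschitz (q dq : R -> R) (A : R) :
  0 <= A -> (forall t, 0 <= q t) -> (forall t, is_derive t 1 q (dq t)) ->
  (forall t, `|dq t| <= 2 * A * Num.sqrt (q t)) ->
  forall s t, `|Num.sqrt (q t) - Num.sqrt (q s)| <= A * `|t - s|.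
Proof.
move=> A0 q0 qP dq_le s t.
wlog st : s t / s <= t.
  move=> wl; case/orP: (le_total s t) => st; first exact: wl.
  by rewrite distrC (distrC t); exact: wl.
have reg e : 0 < e -> `|Num.sqrt (q t + e) - Num.sqrt (q s + e)| <= A * (t - s).
  move=> e0.
  have qe0 r : 0 < q r + e by rewrite ltr_wpDl.
  pose dr r := dq r / (2 * Num.sqrt (q r + e)).
  have rP (r : R) : is_derive r 1 (fun r => Num.sqrt (q r + e)) (dr r).
    have := qP r => ?.
    have := is_derive1_sqrt (qe0 r) => ?.
    by apply: is_derive_eq; rewrite addr0 mulrC.
  have dr_le r : `|dr r| <= A.
    have s0 : 0 < Num.sqrt (q r + e) by rewrite sqrtr_gt0.
    rewrite normf_div (gtr0_norm (mulr_gt0 _ s0)) // ler_pdivrMr ?mulr_gt0 //.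
    rewrite (le_trans (dq_le r)) // mulrCA -mulrA ler_pM2l // ler_wpM2l //.
    by rewrite ler_sqrt ?lerDl ltW.
  have lP (k r : R) : is_derive r 1 (fun r => k * r) k.
    by apply: is_derive_eq; rewrite /GRing.scale /= mulr1.
  rewrite ler_norml -mulNr !mulrBr; apply/andP; split.
    apply: (@increment_le _ _ _ _ s t (lP (- A)) rP st) => r _.
    by have := dr_le r; rewrite ler_norml => /andP[].
  apply: (@increment_le _ _ _ _ s t rP (lP A) st) => r _.
  by have := dr_le r; rewrite ler_norml => /andP[].
rewrite (@ger0_norm _ (t - s)) ?subr_ge0 //.
apply/ler_addgt0Pr => e e0.
(* Num.sqrt (q + d) is within Num.sqrt d = e / 2 of Num.sqrt q *)
pose d := (e / 2) ^+ 2.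
have d0 : 0 < d by rewrite exprn_gt0 // divr_gt0.
have sq r : Num.sqrt (q r) <= Num.sqrt (q r + d) <= Num.sqrt (q r) + e / 2.
  rewrite ler_sqrt ?addr_ge0 ?lerDl ?(ltW d0) //=.
  rewrite -[leRHS]ger0_norm ?addr_ge0 ?sqrtr_ge0 ?divr_ge0 ?(ltW e0) //.
  rewrite -sqrtr_sqr ler_sqrt ?exprn_ge0 ?addr_ge0 ?sqrtr_ge0 ?divr_ge0 ?(ltW e0) //.
  by rewrite sqrrD sqr_sqrtr // lerD2r lerDl mulrn_wge0 // mulr_ge0 ?sqrtr_ge0 // divr_ge0 ?ltW.
have := reg d d0; have := sq s; have := sq t.
rewrite !ler_norml => /andP[? ?] /andP[? ?] /andP[? ?].
by apply/andP; split; lra.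
Qed.

End RealLine.

(** * Differentiability of finite sums, determinants and row vectors *)

Section Differentiability.
Context {R : realType}.

Section Scalar.
Context {V : normedModType R}.
Implicit Types (a v : V).

Lemma differentiable_bigsum (I : Type) (r : seq I) (F : I -> V -> R) a :
  (forall i, differentiable (F i) a) ->
  differentiable (fun z => \sum_(i <- r) F i z) a.
Proof.
move=> Fa; elim: r => [|i r IH].
  by under eq_fun do rewrite big_nil; exact: differentiable_cst.
by under eq_fun do rewrite big_cons; exact: differentiableD.
Qed.

Lemma differentiable_bigprod (I : Type) (r : seq I) (F : I -> V -> R) a :
  (forall i, differentiable (F i) a) ->
  differentiable (fun z => \prod_(i <- r) F i z) a.
Proof.
move=> Fa; elim: r => [|i r IH].
  by under eq_fun do rewrite big_nil; exact: differentiable_cst.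
by under eq_fun do rewrite big_cons; exact: differentiableM.
Qed.

Lemma differentiable_det m (A : V -> 'M[R]_m) a :
  (forall i j, differentiable (fun z => A z i j) a) ->
  differentiable (fun z => \det (A z)) a.
Proof.
move=> Aa; rewrite /determinant; apply: differentiable_bigsum => s.
apply: differentiableM; first exact: differentiable_cst.
exact: differentiable_bigprod.
Qed.

Lemma differentiable_cofactor m (A : V -> 'M[R]_m) a i j :
  (forall i j, differentiable (fun z => A z i j) a) ->
  differentiable (fun z => cofactor (A z) i j) a.
Proof.
move=> Aa; rewrite /cofactor.
apply: differentiableM; first exact: differentiable_cst.
apply: differentiable_det => k l.
by under eq_fun do rewrite !mxE; exact: Aa.
Qed.

Lemma differentiable_rV m (f : V -> 'rV[R]_m) a :
  (forall j, differentiable (fun z => f z 0 j) a) -> differentiable f a.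
Proof.
move=> fa.
rewrite (_ : f = \sum_(j < m) (fun z => f z 0 j *: delta_mx 0 j)); last first.
  by apply/funext => z; rewrite fct_sumE {1}[f z]row_sum_delta.
by apply: differentiable_sum => j; exact: differentiableZl.
Qed.

Lemma derive_lincomb m (f : 'rV[R]_m -> V) (a v : 'rV[R]_m) : differentiable f a ->
  'D_v f a = \sum_j v 0 j *: 'D_(delta_mx 0 j) f a.
Proof.
move=> fa; rewrite deriveE // {1}[v]row_sum_delta linear_sum.
by apply: eq_bigr => j _; rewrite linearZ deriveE.
Qed.

End Scalar.

Lemma deriveZv (V W : normedModType R) (f : V -> W) a v (k : R) :
  differentiable f a -> 'D_(k *: v) f a = k *: 'D_v f a.
Proof. by move=> fa; rewrite !deriveE // linearZ. Qed.

Lemma derive_comp (U V W : normedModType R) (f : U -> V) (h : V -> W) a v :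
  differentiable f a -> differentiable h (f a) ->
  'D_v (h \o f) a = 'D_('D_v f a) h (f a).
Proof.
move=> fa hfa; rewrite !deriveE //; last exact: differentiable_comp.
by rewrite diff_comp.
Qed.

End Differentiability.

(** * Charts, tangent vectors and curves *)

Section Charts.
Context {R : realType} {n : nat} {M : smoothManifold R n}.
Implicit Types (c d e : chart R n M) (p q : M).

Definition transition c d := chart_map d \o chart_inv c.

Lemma transition_at c d p : chart_dom c p -> transition c d (chart_map c p) = chart_map d p.
Proof. by move=> cp; rewrite /transition /= chart_mapK. Qed.

Lemma near_chart_dom c d p : chart_dom c p -> chart_dom d p ->
  \forall z \near chart_map c p,
    [/\ chart_dom c (chart_inv c z), chart_dom d (chart_inv c z) &
        chart_map c (chart_inv c z) = z].
Proof.
move=> cp dp.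
have imp : (chart_map c @` chart_dom c) (chart_map c p) by exists p.
have H1 : \forall z \near chart_map c p, (chart_map c @` chart_dom c) z.
  by apply: open_nbhs_nbhs; split=> //; exact: chart_im_open.
have H2 : \forall z \near chart_map c p, chart_dom d (chart_inv c z).
  have /= := @chart_inv_continuous _ _ _ c _ imp; apply.
  by rewrite chart_mapK //; apply: open_nbhs_nbhs; split=> //; exact: chart_dom_open.
near=> z; have [q cq qz] : (chart_map c @` chart_dom c) z by near: z.
have dz : chart_dom d (chart_inv c z) by near: z.
by split=> //; rewrite -qz chart_mapK.
Unshelve. all: by end_near. Qed.

Lemma transition_differentiable c d p : atlas c -> atlas d ->
  chart_dom c p -> chart_dom d p -> differentiable (transition c d) (chart_map c p).
Proof.
move=> ac ad cp dp.
by apply: (transition_smooth ac ad [::]); exists p.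
Qed.

(** The cocycle identity of the differentials of transition maps; it is what
    makes the representation of tangent vectors independent of charts. *)
Lemma derive_transition c d e p v : atlas c -> atlas d -> atlas e ->
  chart_dom c p -> chart_dom d p -> chart_dom e p ->
  'D_('D_v (transition c d) (chart_map c p)) (transition d e) (chart_map d p) =
  'D_v (transition c e) (chart_map c p).
Proof.
move=> ac ad ae cp dp ep.
rewrite -(transition_at d cp) -derive_comp; last 2 first.
- exact: transition_differentiable.
- by rewrite transition_at //; exact: transition_differentiable.
apply: near_eq_derive.
near=> z; have [] : [/\ chart_dom c (chart_inv c z), chart_dom d (chart_inv c z) &
        chart_map c (chart_inv c z) = z] by near: z; exact: near_chart_dom.
by move=> _ dz _; rewrite /transition /= chart_mapK.
Unshelve. all: by end_near. Qed.

Lemma derive_transition_id c p v : chart_dom c p ->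
  'D_v (transition c c) (chart_map c p) = v.
Proof.
move=> cp; rewrite -[RHS](derive_id (chart_map c p)); apply: near_eq_derive.
near=> z; have [] : [/\ chart_dom c (chart_inv c z), chart_dom c (chart_inv c z) &
        chart_map c (chart_inv c z) = z] by near: z; exact: near_chart_dom.
by [].
Unshelve. all: by end_near. Qed.

Lemma componentsK c p (v : tangent p) : atlas c -> chart_dom c p ->
  of_components c p (components c v) = v.
Proof.
move=> ac cp; rewrite /of_components /components.
rewrite -!/(transition _ _) derive_transition ?derive_transition_id //;
  by [exact: chart_at_dom | exact: chart_at_atlas].
Qed.

Lemma of_componentsK c p u : atlas c -> chart_dom c p ->
  components c (of_components c p u) = u.
Proof.
move=> ac cp; rewrite /of_components /components.
rewrite -!/(transition _ _) derive_transition ?derive_transition_id //;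
  by [exact: chart_at_dom | exact: chart_at_atlas].
Qed.

Lemma components_chart_at p (v : tangent p) : components (chart_at p) v = v.
Proof. by rewrite /components derive_transition_id //; exact: chart_at_dom. Qed.

Lemma of_components_chart_at p u : of_components (chart_at p) p u = u.
Proof. by rewrite /of_components derive_transition_id //; exact: chart_at_dom. Qed.

Section Curve.
Variable x : R -> M.
Hypothesis xsmooth : smooth_curve x.

Lemma near_curve_dom c t : chart_dom c (x t) -> \forall s \near t, chart_dom c (x s).
Proof.
move=> cx; apply: (xsmooth.1 t).
by apply: open_nbhs_nbhs; split=> //; exact: chart_dom_open.
Qed.

Lemma curve_differentiable c t : atlas c -> chart_dom c (x t) ->
  differentiable (chart_map c \o x) t.
Proof. by move=> ac cx; exact: (xsmooth.2 c ac [::] t cx). Qed.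

(** The velocity at [s] is stored in the preferred chart of [x s], which varies
    with [s] without any continuity; in a fixed chart it is the derivative of
    the coordinates. *)
Lemma components_velocity c t : atlas c -> chart_dom c (x t) ->
  components c (velocity x t) = 'D_1 (chart_map c \o x) t.
Proof.
move=> ac cx; rewrite /components /velocity derive1E.
have ad := chart_at_atlas (x t).
have dx := chart_at_dom (x t).
rewrite -/(transition _ _) -[chart_map _ (x t)]/((chart_map (chart_at (x t)) \o x) t).
rewrite -derive_comp; last 2 first.
- exact: curve_differentiable.
- exact: transition_differentiable.
apply: near_eq_derive.
have := near_curve_dom dx; apply: filterS => s ds.
by rewrite /= transition_at.
Qed.

End Curve.

End Charts.

(** * The metric and its Christoffel symbols in a chart *)

Section Metric.
Context {R : realType} {n : nat} {M : smoothManifold R n}.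
Variable g : riemannianMetric M.
Implicit Types (c d : chart R n M) (p q : M).

Lemma inner0l p (w : 'rV[R]_n) : inner g (p := p) 0 w = 0.
Proof.
by have := inner_linearl g p 1 0 0 w; rewrite scaler0 addr0 mul1r => H; lra.
Qed.

Lemma innerDl p (u v w : 'rV[R]_n) :
  inner g (p := p) (u + v) w = inner g (p := p) u w + inner g (p := p) v w.
Proof. by rewrite -{1}[u]scale1r inner_linearl mul1r. Qed.

Lemma innerZl p k (u w : 'rV[R]_n) :
  inner g (p := p) (k *: u) w = k * inner g (p := p) u w.
Proof. by rewrite -{1}[k *: u]addr0 inner_linearl inner0l addr0. Qed.

Lemma innerDr p (u v w : 'rV[R]_n) :
  inner g (p := p) w (u + v) = inner g (p := p) w u + inner g (p := p) w v.
Proof. by rewrite inner_sym innerDl !(inner_sym g w). Qed.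

Lemma innerZr p k (u w : 'rV[R]_n) :
  inner g (p := p) w (k *: u) = k * inner g (p := p) w u.
Proof. by rewrite inner_sym innerZl (inner_sym g w). Qed.

Lemma inner_ge0 p (u : tangent p) : 0 <= inner g u u.
Proof.
have [->|u0] := eqVneq (u : 'rV[R]_n) 0; first by rewrite inner0l.
by rewrite ltW // inner_gt0.
Qed.

Lemma norm_ge0 p (u : tangent p) : 0 <= tangent_norm g u.
Proof. exact: sqrtr_ge0. Qed.

Lemma norm_sqr p (u : tangent p) : tangent_norm g u ^+ 2 = inner g u u.
Proof. by rewrite sqr_sqrtr // inner_ge0. Qed.

Lemma norm_normalize p (u : 'rV[R]_n) : u != 0 ->
  let N := tangent_norm g (p := p) u in
  0 < N /\ tangent_norm g (p := p) (N^-1 *: u) = 1.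
Proof.
move=> u0 N; have N0 : 0 < N by rewrite sqrtr_gt0 inner_gt0.
split=> //; rewrite /tangent_norm innerZl innerZr -norm_sqr -/N mulrA -expr2.
by rewrite -exprMn mulVf ?gt_eqF // expr1n sqrtr1.
Qed.

(** Expand [0 <= |<w, w> u - <u, w> w|^2]. *)
Lemma cauchy_schwarz p (u w : tangent p) :
  `|inner g u w| <= tangent_norm g u * tangent_norm g w.
Proof.
have nn : 0 <= tangent_norm g u * tangent_norm g w by rewrite mulr_ge0 ?norm_ge0.
rewrite -[leRHS]ger0_norm // -ler_sqr ?nnegrE // !real_normK ?num_real //.
rewrite exprMn !norm_sqr.
have [->|w0] := eqVneq (w : 'rV[R]_n) 0.
  by rewrite (inner_sym g u) !inner0l mulr0 expr0n.
have ww := inner_gt0 g p w0.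
have := inner_ge0 (p := p) (inner g w w *: (u : 'rV_n) - inner g u w *: (w : 'rV_n)).
rewrite -scaleNr !(innerDl, innerDr, innerZl, innerZr) (inner_sym g w u).
set a := inner g u u; set b := inner g u w; set c := inner g w w in ww *.
move=> H; have : 0 <= c * (a * c - b ^+ 2) by lra.
by rewrite pmulr_rge0 // subr_ge0.
Qed.

Lemma gram_sym c y i j : gram g c y i j = gram g c y j i.
Proof. by rewrite !mxE inner_sym. Qed.

Lemma dgram_sym c y l i j : dgram g c y l i j = dgram g c y l j i.
Proof. by rewrite /dgram; congr ('D_ _ _ _); apply/funext => z; exact: gram_sym. Qed.

Lemma inner_sumr p (I : Type) (r : seq I) (k : I -> R) (f : I -> 'rV[R]_n) (u : 'rV[R]_n) :
  inner g (p := p) u (\sum_(i <- r) k i *: f i) = \sum_(i <- r) k i * inner g (p := p) u (f i).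
Proof.
elim: r => [|i r IH]; first by rewrite !big_nil inner_sym inner0l.
by rewrite !big_cons innerDr innerZr IH.
Qed.

Lemma of_components_sum c p u : atlas c -> chart_dom c p ->
  of_components c p u = \sum_j u 0 j *: (of_components c p (delta_mx 0 j) : 'rV_n) :> 'rV_n.
Proof.
move=> ac cp; rewrite /of_components -derive_lincomb //.
by apply: transition_differentiable => //; [exact: chart_at_atlas|exact: chart_at_dom].
Qed.

Lemma inner_of_components c p u w : atlas c -> chart_dom c p ->
  inner g (of_components c p u) (of_components c p w) =
  \sum_i \sum_j gram g c (chart_map c p) i j * u 0 i * w 0 j.
Proof.
move=> ac cp.
rewrite (of_components_sum u ac cp) (of_components_sum w ac cp) inner_sumr exchange_big.
apply: eq_bigr => j _; rewrite inner_sym inner_sumr mulr_sumr; apply: eq_bigr => i _.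
by rewrite mxE chart_mapK // inner_sym; ring.
Qed.

Lemma inner_of_componentsE c p u w : atlas c -> chart_dom c p ->
  inner g (of_components c p u) (of_components c p w) =
  \sum_j (u *m gram g c (chart_map c p)) 0 j * w 0 j.
Proof.
move=> ac cp; rewrite inner_of_components // exchange_big; apply: eq_bigr => j _.
by rewrite mxE mulr_suml; apply: eq_bigr => i _; ring.
Qed.

Lemma inner_chart_at p (u w : tangent p) :
  inner g u w = \sum_i \sum_j gram g (chart_at p) (chart_map (chart_at p) p) i j * u 0 i * w 0 j.
Proof.
rewrite -inner_of_components; [|exact: chart_at_atlas|exact: chart_at_dom].
by rewrite !of_components_chart_at.
Qed.

(** A vector in the kernel of the Gram matrix has norm 0. *)
Lemma gram_unit c p : atlas c -> chart_dom c p ->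
  gram g c (chart_map c p) \in unitmx.
Proof.
move=> ac cp; rewrite -row_free_unit -kermx_eq0; apply/rowV0P => v /sub_kermxP vG.
apply/eqP; rewrite -[v](of_componentsK v ac cp).
have [->|v0] := eqVneq (of_components c p v : 'rV_n) 0.
  by rewrite /components derive0.
have := inner_gt0 g p v0; rewrite inner_of_componentsE // vG big1 ?ltxx // => j _.
by rewrite mxE mul0r.
Qed.

Lemma gram_differentiable c p i j : atlas c -> chart_dom c p ->
  differentiable (fun z => gram g c z i j) (chart_map c p).
Proof. by move=> ac cp; apply: (inner_smooth g ac i j [::]); exists p. Qed.

(** Lowering the upper index cancels the inverse metric and leaves the Christoffel
    symbols of the first kind. *)
Lemma christoffel_formE c p (u v : 'rV[R]_n) : atlas c -> chart_dom c p ->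
  let y := chart_map c p in
  christoffel_form g c y u v *m gram g c y =
  \row_l (2^-1 * \sum_i \sum_j
    (dgram g c y i j l + dgram g c y j i l - dgram g c y l i j) * u 0 i * v 0 j).
Proof.
move=> ac cp y.
set S := \row_l _.
have Gu : gram g c y \in unitmx by exact: gram_unit.
have GT : (gram g c y)^T = gram g c y by apply/matrixP => i j; rewrite mxE gram_sym.
suff -> : christoffel_form g c y u v = S *m invmx (gram g c y) by rewrite mulmxKV.
apply/rowP => k; rewrite !mxE.
under eq_bigr do under eq_bigr do rewrite /christoffel mulr_sumr !mulr_suml.
under eq_bigr do rewrite exchange_big /=.
rewrite exchange_big /=; apply: eq_bigr => l _; rewrite mxE.
rewrite -[in RHS]GT -trmx_inv mxE mulrC !mulr_sumr; apply: eq_bigr => i _.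
by rewrite !mulr_sumr; apply: eq_bigr => j _; ring.
Qed.

(** Compatibility of the Levi-Civita connection with the metric, contracted with
    three vectors: in the sum of the two lowered Christoffel forms, the terms
    other than [d_l g_ij] cancel by the symmetry of [g]. *)
Lemma christoffel_compat c p (xi u w : 'rV[R]_n) : atlas c -> chart_dom c p ->
  let y := chart_map c p in
  \sum_i \sum_j gram g c y i j * christoffel_form g c y xi u 0 i * w 0 j +
  \sum_i \sum_j gram g c y i j * u 0 i * christoffel_form g c y xi w 0 j =
  \sum_i \sum_j (\sum_l xi 0 l * dgram g c y l i j) * u 0 i * w 0 j.
Proof.
move=> ac cp y.
pose S j l i := dgram g c y l i j + dgram g c y i l j - dgram g c y j l i.
have E1 u' w' : \sum_i \sum_j gram g c y i j * christoffel_form g c y xi u' 0 i * w' 0 j =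
    \sum_j \sum_l \sum_i 2^-1 * S j l i * xi 0 l * u' 0 i * w' 0 j.
  rewrite exchange_big; apply: eq_bigr => j _.
  transitivity ((christoffel_form g c y xi u' *m gram g c y) 0 j * w' 0 j).
    by rewrite mxE mulr_suml; apply: eq_bigr => i _; ring.
  rewrite christoffel_formE // mxE mulr_sumr mulr_suml; apply: eq_bigr => l _.
  by rewrite mulr_sumr mulr_suml; apply: eq_bigr => i _; rewrite /S; ring.
have -> : \sum_i \sum_j gram g c y i j * u 0 i * christoffel_form g c y xi w 0 j =
          \sum_i \sum_j gram g c y i j * christoffel_form g c y xi w 0 i * u 0 j.
  rewrite exchange_big; apply: eq_bigr => i _; apply: eq_bigr => j _.
  by rewrite gram_sym; ring.
rewrite !E1.
have -> : \sum_j \sum_l \sum_i 2^-1 * S j l i * xi 0 l * u 0 i * w 0 j =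
  \sum_i \sum_j \sum_l 2^-1 * S j l i * xi 0 l * u 0 i * w 0 j.
  by rewrite [RHS]exchange_big; apply: eq_bigr => j _; rewrite exchange_big.
have -> : \sum_j \sum_l \sum_i 2^-1 * S j l i * xi 0 l * w 0 i * u 0 j =
  \sum_i \sum_j \sum_l 2^-1 * S i l j * xi 0 l * w 0 j * u 0 i.
  by apply: eq_bigr => j _; rewrite exchange_big.
rewrite -big_split; apply: eq_bigr => i _ /=; rewrite -big_split; apply: eq_bigr => j _ /=.
rewrite -big_split !mulr_suml; apply: eq_bigr => l _ /=.
by rewrite /S (dgram_sym c y l j i); field.
Qed.

End Metric.

(** * Compatibility of the connection with the metric along a curve *)

Section Compat.
Context {R : realType} {n : nat} {M : smoothManifold R n}.
Variable g : riemannianMetric M.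
Implicit Types (c d : chart R n M) (p q : M).

Lemma is_derive_mul3 (f h k : R -> R) (t df dh dk : R) :
  is_derive t 1 f df -> is_derive t 1 h dh -> is_derive t 1 k dk ->
  is_derive t 1 (f * h * k) (df * h t * k t + (f t * dh * k t + f t * h t * dk)).
Proof.
move=> ? ? ?; apply: is_derive_eq; rewrite /GRing.scale /=.
rewrite -[(f * h) t]/(f t * h t); ring.
Qed.

Section Along.
Variable x : R -> M.
Hypothesis xsmooth : smooth_curve x.
Implicit Types X W : forall t, tangent (x t).

(** Near [t] both vectors are read in the preferred chart of [x t], where their
    product is a finite sum of products of three functions; the derivative of the
    factor [g_ij] supplies the Christoffel terms of the covariant derivatives. *)
Lemma is_derive_inner X W t :
  derivable (fun s => components (chart_at (x t)) (X s)) t 1 ->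
  derivable (fun s => components (chart_at (x t)) (W s)) t 1 ->
  is_derive t 1 (fun s => inner g (X s) (W s))
    (inner g (cov_deriv_along g X t) (W t) + inner g (X t) (cov_deriv_along g W t)).
Proof.
set c := chart_at (x t).
set a := fun s => components c (X s); set b := fun s => components c (W s).
move=> da db.
have ac : atlas c by exact: chart_at_atlas.
have cx : chart_dom c (x t) by exact: chart_at_dom.
set y := chart_map c (x t).
set G := fun i j => gram g c y i j.
set y' := velocity x t : 'rV[R]_n.
have Gd i j : is_derive t 1 (fun s => gram g c (chart_map c (x s)) i j)
    (\sum_l y' 0 l * dgram g c y l i j).
  have dG : differentiable (fun z => gram g c z i j) ((chart_map c \o x) t).
    exact: gram_differentiable.
  have dy := curve_differentiable xsmooth ac cx.
  have -> : \sum_l y' 0 l * dgram g c y l i j =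
      'D_1 ((fun z => gram g c z i j) \o (chart_map c \o x)) t.
    by rewrite derive_comp // (derive_lincomb _ dG) /y' /velocity derive1E.
  exact: derivableP (@diff_derivable _ _ _ _ _ (1 : R) (differentiable_comp dy dG)).
have ad j : is_derive t 1 (fun s => a s 0 j) (('D_1 a t) 0 j).
  have H := (derivable_mxP a t 1).1 da 0 j.
  rewrite (derive_mx da) mxE.
  exact: derivableP H.
have bd j : is_derive t 1 (fun s => b s 0 j) (('D_1 b t) 0 j).
  have H := (derivable_mxP b t 1).1 db 0 j.
  rewrite (derive_mx db) mxE.
  exact: derivableP H.
have aE : a t = X t by exact: components_chart_at.
have bE : b t = W t by exact: components_chart_at.
pose q : R -> R := \sum_i \sum_j
  ((fun s => gram g c (chart_map c (x s)) i j) * (fun s => a s 0 i) * (fun s => b s 0 j)).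
have qP : is_derive t 1 q
   (\sum_i \sum_j ((\sum_l y' 0 l * dgram g c y l i j) * a t 0 i * b t 0 j +
       (G i j * ('D_1 a t) 0 i * b t 0 j + G i j * a t 0 i * ('D_1 b t) 0 j))).
  apply: is_derive_sum => i; apply: is_derive_sum => j.
  exact: is_derive_mul3 (Gd i j) (ad i) (bd j).
apply: (@near_eq_is_derive _ _ _ q).
  have := near_curve_dom xsmooth cx; apply: filterS => s cs.
  rewrite -[X s](componentsK _ ac cs) -[W s](componentsK _ ac cs) inner_of_components //.
  rewrite /q fct_sumE; apply: eq_bigr => i _; rewrite fct_sumE; apply: eq_bigr => j _.
  by rewrite /a /b.
apply: is_derive_eq qP _.
under eq_bigr do rewrite big_split /=.
rewrite big_split /= aE bE -christoffel_compat //.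
rewrite !inner_chart_at -/c -/y /cov_deriv_along -/c -/a -/b !derive1E -/y -/y' -!big_split.
apply: eq_bigr => i _ /=; rewrite -!big_split; apply: eq_bigr => j _ /=.
have addE (u v : 'rV[R]_n) k : (u + v) 0 k = u 0 k + v 0 k by rewrite mxE.
by rewrite !addE /G; ring.
Qed.

End Along.
End Compat.

(** * Gradient and Hessian *)

Section Gradient.
Context {R : realType} {n : nat} {M : smoothManifold R n}.
Variable g : riemannianMetric M.
Implicit Types (c d : chart R n M) (p q : M).
Variable U : M -> R.
Hypothesis Usmooth : smooth_function U.

Lemma function_differentiable c p : atlas c -> chart_dom c p ->
  differentiable (U \o chart_inv c) (chart_map c p).
Proof. by move=> ac cp; apply: (Usmooth ac [::]); exists p. Qed.

Lemma partial_differentiable c p v : atlas c -> chart_dom c p ->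
  differentiable ('D_v (U \o chart_inv c)) (chart_map c p).
Proof. by move=> ac cp; apply: (Usmooth ac [:: v]); exists p. Qed.

Lemma derive_function_transition c d p v : atlas c -> atlas d ->
  chart_dom c p -> chart_dom d p ->
  'D_('D_v (transition c d) (chart_map c p)) (U \o chart_inv d) (chart_map d p) =
  'D_v (U \o chart_inv c) (chart_map c p).
Proof.
move=> ac ad cp dp.
rewrite -(transition_at d cp) -derive_comp; last 2 first.
- exact: transition_differentiable.
- by rewrite transition_at //; exact: function_differentiable.
apply: near_eq_derive; have := near_chart_dom cp dp; apply: filterS => z [_ dz _].
by rewrite /transition /= chart_mapK.
Qed.

(** The gradient represents the differential of [U], in any chart. *)
Lemma inner_gradient c p u : atlas c -> chart_dom c p ->
  inner g (gradient g U p) (of_components c p u) = 'D_u (U \o chart_inv c) (chart_map c p).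
Proof.
move=> ac cp; set d := chart_at p.
have ad : atlas d by exact: chart_at_atlas.
have dp : chart_dom d p by exact: chart_at_dom.
rewrite -[in LHS](of_components_chart_at p (gradient g U p)).
rewrite -[in LHS](of_components_chart_at p (of_components c p u)) inner_of_componentsE //.
rewrite /gradient -/d mulmxKV ?gram_unit // -(derive_function_transition _ ac ad cp dp).
rewrite [RHS]derive_lincomb; last exact: function_differentiable.
by apply: eq_bigr => j _; rewrite mxE mulrC.
Qed.

Lemma inner_gradient_at p (u : tangent p) :
  inner g (gradient g U p) u = 'D_u (U \o chart_inv (chart_at p)) (chart_map (chart_at p) p).
Proof.
rewrite -[in LHS](of_components_chart_at p u) inner_gradient //;
  by [exact: chart_at_atlas|exact: chart_at_dom].
Qed.

(** The coordinates of the gradient in a fixed chart, [g^ij d_i U].  The inverse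
    matrix is written with cofactors, as differentiability is then that of
    polynomials in the entries and of the inverse of a nonzero scalar. *)
Definition gradient_coords c (z : 'rV[R]_n) : 'rV[R]_n :=
  \row_j \sum_i 'D_(delta_mx 0 i) (U \o chart_inv c) z *
     ((\det (gram g c z))^-1 * cofactor (gram g c z) j i).

Lemma components_gradient c p : atlas c -> chart_dom c p ->
  components c (gradient g U p) = gradient_coords c (chart_map c p).
Proof.
move=> ac cp; set G := gram g c (chart_map c p).
have Gu : G \in unitmx by exact: gram_unit.
transitivity ((\row_j 'D_(delta_mx 0 j) (U \o chart_inv c) (chart_map c p)) *m invmx G).
  rewrite -[LHS](mulmxK Gu); congr (_ *m _); apply/rowP => j.
  rewrite [RHS]mxE -inner_gradient // -[X in inner g X _](componentsK _ ac cp).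
  rewrite inner_of_componentsE // (bigD1 j) //= [X in _ + X]big1 => [|k kj].
    by rewrite addr0 [X in _ = _ * X]mxE !eqxx mulr1.
  by rewrite [X in _ * X = _]mxE (negbTE kj) andbF mulr0.
apply/rowP => j; rewrite !mxE; apply: eq_bigr => i _.
by rewrite mxE /invmx Gu !mxE.
Qed.

Lemma gradient_coords_differentiable c p : atlas c -> chart_dom c p ->
  differentiable (gradient_coords c) (chart_map c p).
Proof.
move=> ac cp; apply: differentiable_rV => j.
under eq_fun do rewrite mxE.
have dG i k : differentiable (fun z => gram g c z i k) (chart_map c p).
  exact: gram_differentiable.
apply: differentiable_bigsum => i.
apply: differentiableM; first exact: partial_differentiable.
apply: differentiableM; last exact: differentiable_cofactor.
apply: differentiableV; first exact: differentiable_det.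
by have := gram_unit g ac cp; rewrite unitmxE unitfE.
Qed.

Lemma cov_deriv_gradient p (xi : tangent p) (c := chart_at p) (y := chart_map c p) :
  cov_deriv g (gradient g U) xi = 'D_xi (gradient_coords c) y
    + christoffel_form g c y xi (gradient g U p) :> 'rV_n.
Proof.
have ac : atlas c by exact: chart_at_atlas.
have cp : chart_dom c p by exact: chart_at_dom.
have E : 'D_xi (fun z => components c (gradient g U (chart_inv c z))) y =
    'D_xi (gradient_coords c) y.
  apply: near_eq_derive; have := near_chart_dom cp cp; apply: filterS => z [cz _ zE].
  by rewrite (components_gradient ac cz) zE.
exact: (congr1 (fun v : 'rV[R]_n => v + christoffel_form g c y xi (gradient g U p)) E).
Qed.

Lemma hessian_formZ p k (xi : tangent p) :
  hessian_form g U (k *: (xi : 'rV_n) : tangent p) = k ^+ 2 * hessian_form g U xi.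
Proof.
rewrite /hessian_form innerZr !cov_deriv_gradient deriveZv; last first.
  by apply: gradient_coords_differentiable; [exact: chart_at_atlas|exact: chart_at_dom].
set c := chart_at p; set y := chart_map c p.
have -> : christoffel_form g c y (k *: (xi : 'rV_n)) (gradient g U p) =
    k *: christoffel_form g c y xi (gradient g U p).
  apply/rowP => l; rewrite !mxE mulr_sumr; apply: eq_bigr => i _.
  by rewrite mulr_sumr; apply: eq_bigr => j _; rewrite mxE; ring.
by rewrite -scalerDr innerZl mulrA -expr2.
Qed.

(** From unit vectors to all vectors, the Hessian form being homogeneous of
    degree 2. *)
Lemma hessian_ge (l : R) p (xi : tangent p) :
  (l%:E <= hessian_min g U p)%E -> l * tangent_norm g xi ^+ 2 <= hessian_form g U xi.
Proof.
move=> lmin; have [xi0|xi0] := eqVneq (xi : 'rV[R]_n) 0.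
  rewrite norm_sqr xi0 inner0l mulr0.
  have -> : (0 : tangent p) = (0 *: (0 : 'rV[R]_n)) by rewrite scale0r.
  by rewrite hessian_formZ expr0n mul0r.
have [N0 e1] := norm_normalize g p xi0.
set k := tangent_norm g xi in N0 e1 *.
pose e : tangent p := k^-1 *: (xi : 'rV[R]_n).
have xiE : xi = k *: (e : 'rV[R]_n) by rewrite /e scalerA divff ?scale1r // gt_eqF.
rewrite xiE hessian_formZ mulrC ler_pM2l ?exprn_gt0 // -lee_fin.
by apply: le_trans lmin _; apply: ereal_inf_lbound; exists e.
Qed.

Section Curve.
Variable x : R -> M.
Hypothesis xsmooth : smooth_curve x.

Lemma velocity_derivable (t : R) :
  derivable (fun s => components (chart_at (x t)) (velocity x s)) t 1.
Proof.
set c := chart_at (x t).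
have ac : atlas c by exact: chart_at_atlas.
have cx : chart_dom c (x t) by exact: chart_at_dom.
apply: (@near_eq_derivable _ _ _ ('D_1 (chart_map c \o x))).
  have := near_curve_dom xsmooth cx; apply: filterS => s cs.
  by rewrite components_velocity.
by apply: diff_derivable; exact: (xsmooth.2 c ac [:: 1] t cx).
Qed.

Lemma near_gradient (t : R) (c := chart_at (x t)) :
  \forall s \near t, (gradient_coords c \o (chart_map c \o x)) s =
    components c (gradient g U (x s)).
Proof.
have ac : atlas c by exact: chart_at_atlas.
have cx : chart_dom c (x t) by exact: chart_at_dom.
have := near_curve_dom xsmooth cx; apply: filterS => s cs.
by rewrite (components_gradient ac cs).
Qed.

Lemma gradient_along_derivable (t : R) :
  derivable (fun s => components (chart_at (x t)) (gradient g U (x s))) t 1.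
Proof.
apply: near_eq_derivable (near_gradient t) _; apply: diff_derivable.
have ac : atlas (chart_at (x t)) by exact: chart_at_atlas.
have cx := chart_at_dom (x t).
by apply: differentiable_comp; [exact: curve_differentiable|exact: gradient_coords_differentiable].
Qed.

Lemma cov_deriv_along_gradient (t : R) :
  cov_deriv_along g (fun s => gradient g U (x s)) t =
  cov_deriv g (gradient g U) (velocity x t) :> 'rV_n.
Proof.
have ac : atlas (chart_at (x t)) by exact: chart_at_atlas.
have cx := chart_at_dom (x t).
rewrite cov_deriv_gradient.
apply: (congr1 (fun v : 'rV[R]_n =>
  v + christoffel_form g _ _ (velocity x t) (gradient g U (x t)))).
rewrite derive1E -(near_eq_derive _ (near_gradient t)) derive_comp; last 2 first.
- exact: curve_differentiable.
- exact: gradient_coords_differentiable.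
by rewrite /velocity derive1E.
Qed.

Lemma is_derive_potential (t : R) :
  is_derive t 1 (fun s => U (x s)) (inner g (gradient g U (x t)) (velocity x t)).
Proof.
set c := chart_at (x t).
have ac : atlas c by exact: chart_at_atlas.
have cx : chart_dom c (x t) by exact: chart_at_dom.
have dx := curve_differentiable xsmooth ac cx.
have dU := function_differentiable ac cx.
rewrite inner_gradient_at /velocity derive1E -derive_comp //.
apply: near_eq_is_derive
  (derivableP (@diff_derivable _ _ _ _ _ (1 : R) (differentiable_comp dx dU))).
have := near_curve_dom xsmooth cx; apply: filterS => s cs.
by rewrite /= chart_mapK.
Qed.

Lemma is_derive2_potential (t : R) :
  is_derive t 1 (fun s => inner g (gradient g U (x s)) (velocity x s))
   (hessian_form g U (velocity x t) + inner g (gradient g U (x t)) (acceleration g x t)).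
Proof.
rewrite /hessian_form -cov_deriv_along_gradient.
apply: (@is_derive_inner _ _ _ g x xsmooth (fun s => gradient g U (x s)) (velocity x)).
- exact: gradient_along_derivable.
- exact: velocity_derivable.
Qed.

Lemma is_derive_speed2 (t : R) :
  is_derive t 1 (fun s => inner g (velocity x s) (velocity x s))
   (2 * inner g (acceleration g x t) (velocity x t)).
Proof.
rewrite mulr_natl mulr2n {2}inner_sym.
by apply: is_derive_inner => //; exact: velocity_derivable.
Qed.

End Curve.
End Gradient.

(** * The velocity bound *)

Section Bound.
Context {R : realType} {n : nat} {M : smoothManifold R n}.
Variable g : riemannianMetric M.

Lemma norm_le_sup_norm (x : R -> M) (X : forall t, tangent (x t)) (t : R) :
  ((tangent_norm g (X t))%:E <= sup_norm g X)%E.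
Proof. by apply: ereal_sup_ubound; exists t. Qed.

Lemma sup_norm_fin_num (x : R -> M) (X : forall t, tangent (x t)) :
  (sup_norm g X < +oo)%E -> sup_norm g X \is a fin_num.
Proof.
by move=> X_fin; rewrite ge0_fin_numE // (le_trans _ (norm_le_sup_norm X 0)) // lee_fin norm_ge0.
Qed.

Lemma exists_neq0_of_sup_norm (x : R -> M) (X : forall t, tangent (x t)) :
  (0 < sup_norm g X)%E -> exists t, X t != 0 :> 'rV[R]_n.
Proof.
move=> X0; apply: contrapT => /forallNP X00; move: X0; apply/negP; rewrite -leNgt.
apply: ge_ereal_sup => _ [t _ <-]; rewrite lee_fin.
have /negP := X00 t; rewrite negbK => /eqP Xt.
by rewrite /tangent_norm Xt inner0l sqrtr0.
Qed.

(** The infimum is over a nonempty set as soon as the dimension is positive, as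
    witnessed by a nonzero vector. *)
Lemma hessian_min_lt_pinfty (U : M -> R) (p : M) (u : 'rV[R]_n) :
  u != 0 -> (hessian_min g U p < +oo)%E.
Proof.
move=> u0; have [_ e1] := norm_normalize g p u0; set e := _ *: u in e1.
apply: (@le_lt_trans _ _ (hessian_form g U (e : tangent p))%:E); last exact: ltry.
by apply: ereal_inf_lbound; exists e.
Qed.

Lemma speed_sqr_le (x : R -> M) (U : M -> R) (zeta A G lam B t0 : R) :
  0 < zeta -> zeta ^+ 3 - 3 * zeta - 1 = 0 ->
  smooth_curve x -> smooth_function U ->
  0 < G -> 0 < lam ->
  (forall t, tangent_norm g (acceleration g x t) <= A) ->
  (forall t, tangent_norm g (gradient g U (x t)) <= G) ->
  (forall t, (lam%:E <= hessian_min g U (x t))%E) ->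
  (forall t, U (x t) <= B) ->
  tangent_norm g (velocity x t0) ^+ 2 <= zeta ^+ 2 / lam * G * A.
Proof.
move=> z0 zE xs Us G0 l0 accA gradG hessl UB.
have A0 : 0 <= A by apply: le_trans (accA 0); exact: norm_ge0.
apply: (@speed_le R _ _ _ (fun t => tangent_norm g (velocity x t)) A G lam B zeta t0
  z0 zE A0 G0 l0 (is_derive_potential g Us xs) (is_derive2_potential g Us xs)) => //.
- apply: (@sqrt_lipschitz R _ _ A A0 _ (is_derive_speed2 g xs)) => t; first exact: inner_ge0.
  rewrite normrM ger0_norm // -mulrA ler_pM2l // (le_trans (cauchy_schwarz _ _ _)) //.
  by rewrite ler_wpM2r ?norm_ge0.
- by move=> t; rewrite (le_trans (cauchy_schwarz _ _ _)) // ler_wpM2r ?norm_ge0.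
- move=> t; apply: lerD; first exact: hessian_ge.
  have := cauchy_schwarz g (gradient g U (x t)) (acceleration g x t).
  rewrite ler_norml => /andP[+ _]; apply: le_trans.
  by rewrite lerN2 ler_pM ?norm_ge0.
Qed.

End Bound.

Theorem theorem1 (R : realType) :
  exists C zeta : R,
    [/\ 0 < C, C <= zeta &
        unique (fun z : R => 0 < z /\ z ^+ 3 - 3 * z - 1 = 0) zeta] /\
    forall (n : nat) (M : smoothManifold R n) (g : riemannianMetric M),
      complete_metric g ->
    forall x : R -> M,
      smooth_curve x ->
      (sup_norm g (acceleration g x) < +oo)%E ->
    forall U : M -> R,
      smooth_function U ->
      (ereal_sup [set (U (x t))%:E | t in [set: R]] < +oo)%E ->
      (0 < sup_norm g (fun t => gradient g U (x t)) < +oo)%E ->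
    forall lambda : \bar R,
      lambda = ereal_inf [set hessian_min g U (x t) | t in [set: R]] ->
      (0 < lambda)%E ->
      (sup_norm g (velocity x) ^+ 2 <=
        (C ^+ 2 / fine lambda)%:E
          * sup_norm g (fun t => gradient g U (x t))
          * sup_norm g (acceleration g x))%E.
Proof.
have [zeta zetaP] := cubic_root_exists R; have [[z0 zE] _] := zetaP.
exists zeta, zeta; split; first by split.
move=> n M g _ x xs acc_fin U Us U_fin /andP[grad_gt0 grad_fin] lambda lambdaE lambda_gt0.
have hess_ge t : (lambda <= hessian_min g U (x t))%E.
  by rewrite lambdaE; apply: ereal_inf_lbound; exists t.
(* the gradient is nonzero at some point of the curve, so the dimension is positive *)
have lambda_num : lambda \is a fin_num.
  have [t /(hessian_min_lt_pinfty g U (x t)) hess_fin] := exists_neq0_of_sup_norm grad_gt0.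
  by rewrite ge0_fin_numE ?(ltW lambda_gt0) // (le_lt_trans (hess_ge t)).
have accE := fineK (sup_norm_fin_num acc_fin).
have gradE := fineK (sup_norm_fin_num grad_fin).
set A := fine (sup_norm g (acceleration g x)) in accE.
set G := fine (sup_norm g (fun t => gradient g U (x t))) in gradE.
set l := fine lambda.
have lE : l%:E = lambda by exact: fineK.
have [B UB] : exists B, forall t, U (x t) <= B.
  exists (fine (ereal_sup [set (U (x t))%:E | t in [set: R]])) => t.
  have Ut : ((U (x t))%:E <= ereal_sup [set (U (x t))%:E | t in [set: R]])%E.
    by apply: ereal_sup_ubound; exists t.
  by rewrite -lee_fin fineK // fin_real // U_fin (lt_le_trans _ Ut) // ltNyr.
have speed t : tangent_norm g (velocity x t) ^+ 2 <= zeta ^+ 2 / l * G * A.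
  apply: (@speed_sqr_le _ _ _ g x U zeta A G l B) => //.
  - by rewrite -lte_fin gradE.
  - by rewrite -lte_fin lE.
  - by move=> s; rewrite -lee_fin accE norm_le_sup_norm.
  - by move=> s; rewrite -lee_fin gradE (norm_le_sup_norm g (fun s => gradient g U (x s))).
  - by move=> s; rewrite lE.
rewrite -accE -gradE -!EFinM.
set K := _ * A in speed *.
have K0 : 0 <= K by apply: le_trans (speed 0); exact: sqr_ge0.
have sup_le : (sup_norm g (velocity x) <= (Num.sqrt K)%:E)%E.
  apply: ge_ereal_sup => _ [t _ <-].
  by rewrite lee_fin -ler_sqr ?nnegrE ?norm_ge0 ?sqrtr_ge0 // [leRHS]sqr_sqrtr.
have sup_ge0 : (0 <= sup_norm g (velocity x))%E.
  by rewrite (le_trans _ (norm_le_sup_norm g _ 0)) // lee_fin norm_ge0.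
by rewrite -(sqr_sqrtr K0) EFin_expe !expe2 lee_pmul.
Qed.
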